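(* For all integers $j\ge0$, $n\ge1$ and $w\ge1$, the homology group $H_j(\mathrm{no}_{w+1}(n,\mathbb{R});\mathbb{Z})$ is (isomorphic to) a direct summand of $H_j(\mathrm{config}(n,w);\mathbb{Z})$.
   Context: $\mathrm{config}(n,w)$ is the set of $(x_1,y_1,\dots,x_n,y_n)\in\mathbb{R}^{2n}$ with $(x_i-x_j)^2+(y_i-y_j)^2\ge 1$ for all $i\ne j$ and $\frac12\le y_i\le w-\frac12$ for all $i$ (configurations of $n$ labeled unit-diameter disks in an infinite strip of width $w$). $\mathrm{no}_k(n,\mathbb{R})$ is the set of points of $\mathbb{R}^n$ such that no $k$ of the coordinates are equal. Known fact from earlier work: $\mathrm{config}(n,w)$ is homotopy equivalent to the polyhedral cell complex $\mathrm{cell}(n,w)$ described as follows. Its cells are indexed by symbols, i.e. sequences of nonempty words (blocks), each of length at most $w$, separated by vertical bars, in which each element of $\{1,\dots,n\}$ appears exactly once in total. The cell $f$ is a codimension-1 face of $g$ iff $g$ is obtained from $f$ by removing one bar and merging the two adjacent blocks by a shuffle preserving the order within each of them. *)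

(* Defs.v *)
From HB Require Import structures.
From mathcomp.multinomials Require Import freeg.
From mathcomp Require Import all_boot all_order all_algebra.
From mathcomp Require Import zify.
From mathcomp Require Import all_classical all_reals all_analysis.

Set Implicit Arguments.
Unset Strict Implicit.
Unset Printing Implicit Defensive.

Import Order.TTheory GRing.Theory Num.Theory.
Import numFieldNormedType.Exports.
Import Quotient.

Local Open Scope classical_set_scope.
Local Open Scope ring_scope.

Section AlgebraicHomology.
Variables (A B C : zmodType) (f : {additive A -> B}) (g : {additive B -> C}).

Definition cycle_pred : {pred B} := [pred b | g b == 0].

Fact cycle_pred_zmod_closed : zmod_closed cycle_pred.
Proof.
split=> [|x y]; rewrite !inE ?raddf0 // => /eqP gx0 /eqP gy0.
by rewrite raddfB gx0 gy0 subrr.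
Qed.

HB.instance Definition _ := GRing.isZmodClosed.Build B cycle_pred
  cycle_pred_zmod_closed.

Record cycles : predArgType :=
  Cycle { cycle_val : B ; _ : cycle_val \in cycle_pred }.

HB.instance Definition _ := [isSub for cycle_val].
HB.instance Definition _ := [Choice of cycles by <:].
HB.instance Definition _ := [SubChoice_isSubZmodule of cycles by <:].

Definition boundary_pred : {pred cycles} :=
  [pred z | `[< exists a : A, f a = \val z >]].

Fact boundary_pred_zmod_closed : zmod_closed boundary_pred.
Proof.
split=> [|x y]; rewrite !inE; first by exists 0; rewrite !raddf0.
by move=> [a fa] [b fb]; exists (a - b); rewrite !raddfB fa fb.
Qed.

HB.instance Definition _ := GRing.isZmodClosed.Build cycles boundary_pred
  boundary_pred_zmod_closed.

(* ker g / im f; no hypothesis g \o f = 0 is needed, since boundary_pred only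
   keeps the elements of im f lying in ker g *)
Definition ker_mod_im : zmodType := {quot boundary_pred}.

End AlgebraicHomology.

Section SingularHomology.
Variable R : realType.

Definition std_simplex (j : nat) : set 'rV[R]_j.+1 :=
  [set t | (forall i, 0 <= t 0 i) /\ \sum_i t 0 i = 1].
Arguments std_simplex : clear implicits.

Definition coface_row (j : nat) (i : 'I_j.+2) (t : 'rV[R]_j.+1) : 'rV[R]_j.+2 :=
  \row_k oapp (t 0) 0 (unlift i k).

Fact coface_row_simplex j i (t : set_type (std_simplex j)) :
  coface_row i (\val t) \in std_simplex j.+1.
Proof.
case: t => t /= /set_mem[t0 t1]; apply/mem_set; split=> [k|].
  by rewrite mxE; case: unliftP => [l _|_] /=; first exact: t0.
rewrite (bigD1_ord i) //= mxE unlift_none add0r -[RHS]t1.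
by apply: eq_bigr => k _; rewrite mxE liftK.
Qed.

(* the i-th face inclusion, inserting a zero barycentric coordinate at
   position i *)
Definition coface j (i : 'I_j.+2) (t : set_type (std_simplex j)) :
  set_type (std_simplex j.+1) := 
  exist (fun v => v \in std_simplex j.+1) _ (coface_row_simplex i t).

Fact coface_row_continuous j i : continuous (@coface_row j i).
Proof.
move=> t U [P Pt PU].
exists (fun a l => P a (lift i l)) => [a l|t' Pt'].
  by have := Pt a (lift i l); rewrite mxE liftK /= (ord1 a).
apply: PU => a k; have := Pt a k; rewrite !mxE.
by case: unliftP => [l ->|_] /=; [rewrite -(ord1 a) => _; exact: Pt'|
                                  exact: nbhs_singleton].
Qed.

Fact coface_continuous j i : continuous (@coface j i).
Proof.
apply: continuous_comp_initial => t.
have -> : set_val \o coface i = coface_row i \o set_val by [].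
apply: continuous_comp; first exact: initial_continuous.
exact: coface_row_continuous.
Qed.

HB.instance Definition _ j i :=
  isContinuous.Build _ _ (@coface j i) (@coface_continuous j i).

Variable X : topologicalType.

(* std_simplex and, below, subspaces of Euclidean space are coerced to types
   (set_type) carrying the subspace topology *)
Definition singular_simplex (j : nat) :=
  continuousType (set_type (std_simplex j)) X.

Definition face j (s : singular_simplex j.+1) (i : 'I_j.+2) :
  singular_simplex j := s \o @coface j i.

Definition chain (j : nat) : zmodType := {freeg (singular_simplex j) / int}.

Definition face_sum (j : nat) : chain j.+1 -> chain j :=
  fglift (fun s => \sum_(i < j.+2) << (-1) ^+ i *g face s i >>).

(* in degree 0 the boundary is zero: the homology is unreduced *)
Definition boundary (j : nat) : chain j -> chain j.-1 :=
  if j is k.+1 then @face_sum k else fun=> 0.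

Fact boundary_is_zmod_morphism j : zmod_morphism (@boundary j).
Proof.
case: j => [|j]; first by move=> x y /=; rewrite subr0.
exact: lift_is_additive.
Qed.

HB.instance Definition _ j :=
  GRing.isZmodMorphism.Build _ _ (@boundary j)
    (@boundary_is_zmod_morphism j).

Lemma coface_row_swap j (i i' : 'I_j.+3) (k k' : 'I_j.+2) (t : 'rV[R]_j.+1) :
  lift i k = i' -> lift i' k' = i ->
  coface_row i (coface_row k t) = coface_row i' (coface_row k' t).
Proof.
move=> <- ik; apply/rowP => m; rewrite !mxE.
have [p ->|->] := unliftP i m; last first.
  by rewrite -[X in unlift _ X]ik liftK /= mxE unlift_none.
rewrite /= mxE; have [l ->|->] := unliftP k p; last by rewrite unlift_none.
have -> : lift i (lift k l) = lift (lift i k) (lift k' l).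
  by apply: val_inj; have := congr1 val ik; rewrite /= /bump; lia.
by rewrite liftK /= mxE liftK.
Qed.

Lemma face_swap j (s : singular_simplex j.+2) (i i' : 'I_j.+3) (k k' : 'I_j.+2) :
  lift i k = i' -> lift i' k' = i ->
  face (face s i) k = face (face s i') k'.
Proof.
move=> ik ki; apply/continuousEP => t /=; congr (s _).
by apply: val_inj => /=; exact: coface_row_swap.
Qed.

Lemma boundary_boundary j (c : chain j.+2) : boundary (boundary c) = 0.
Proof.
have scaleU (T : choiceType) (a b : int) (x : T) :
    a *: << b *g x >> = << a * b *g x >> :> {freeg T / int}.
  by apply/eqP/freeg_eqP => y; rewrite coeffZ !coeffU mulrA.
have bU k (z : int) (s : singular_simplex k.+1) :
    face_sum << z *g s >> = \sum_(i < k.+2) << z * (-1) ^+ i *g face s i >>.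
  by rewrite /face_sum liftU scaler_sumr; apply: eq_bigr => i _; rewrite scaleU.
rewrite -[c]freeg_sumE !raddf_sum big1_seq // => s _ /=.
rewrite bU -[face_sum _]/(boundary _) raddf_sum /=.
pose F (p : 'I_j.+3 * 'I_j.+2) : chain j :=
  << coeff s c * (-1) ^+ (p.1 + p.2) *g face (face s p.1) p.2 >>.
transitivity (\sum_p F p).
  rewrite -(pair_bigA _ (fun i k => F (i, k))); apply: eq_bigr => i _ /=.
  by rewrite bU; apply: eq_bigr => k _; rewrite -mulrA -exprD.
pose h (p : 'I_j.+3 * 'I_j.+2) :=
  (lift p.1 p.2, odflt p.2 (unlift (lift p.1 p.2) p.1)).
have hP p : lift (h p).1 (h p).2 = p.1.
  rewrite /h /=; case: unliftP => [k //|e].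
  by have /eqP := neq_lift p.1 p.2; rewrite {1}e.
have hK : involutive h.
  move=> p; rewrite {1}/h hP /= [RHS]surjective_pairing; congr pair.
  by rewrite liftK.
have hlt p : ~~ ((h p).2 < (h p).1)%N = (p.2 < p.1)%N.
  by have := congr1 val (hP p); rewrite /= /bump; lia.
rewrite (bigID (fun p : 'I_j.+3 * 'I_j.+2 => p.2 < p.1)%N) /=.
rewrite [X in _ + X](reindex_inj (inv_inj hK)).
rewrite [X in _ + X](eq_bigl _ _ hlt) -big_split big1 // => p lt_p.
have par : odd ((h p).1 + (h p).2) = ~~ odd (p.1 + p.2).
  by have := congr1 val (hP p); rewrite /= /bump; lia.
suff -> : F (h p) = - F p by rewrite /= subrr.
rewrite /F (@face_swap _ _ _ p.1 _ p.2 (hP p) erefl) freegUN -mulrN.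
by rewrite -signr_odd par -[in RHS]signr_odd; case: odd; rewrite ?opprK.
Qed.

Definition homology (j : nat) : zmodType :=
  ker_mod_im (@boundary j.+1) (@boundary j).

End SingularHomology.

Arguments homology : clear implicits.

Definition isom_direct_summand (A B : zmodType) : Prop :=
  exists (C : zmodType) (phi : {additive (A * C)%type -> B}), bijective phi.

Section Spaces.
Variable R : realType.

(* R^2n as n x 2 matrices: row i is the centre (x_i, y_i) of the i-th disk *)
Definition config (n : nat) (w : R) : set 'M[R]_(n, 2) :=
  [set p | (forall i j, i != j ->
              1 <= (p i 0 - p j 0) ^+ 2 + (p i 1 - p j 1) ^+ 2) /\
           (forall i, 2^-1 <= p i 1 <= w - 2^-1)].

Definition no_equal (k n : nat) : set 'rV[R]_n :=
  [set x | forall A : {set 'I_n}, #|A| = k ->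
             ~ (forall i j, i \in A -> j \in A -> x 0 i = x 0 j)].

End Spaces.

Arguments config : clear implicits.
Arguments no_equal : clear implicits.

(* Main.v *)
Require Import Defs.
From HB Require Import structures.
From mathcomp.multinomials Require Import freeg.
From mathcomp Require Import all_boot all_order all_algebra.
From mathcomp Require Import lra zify.
From mathcomp Require Import all_classical all_reals all_analysis.

(** Disks whose abscissae coincide sit at distance at least 1 above one another
    in a segment of length [w - 1], so at most [w] abscissae are equal and the
    abscissa map [r] sends config(n,w) to no_{w+1}(n,R).  Conversely, multiply a
    point [x] of no_{w+1}(n,R) by a positive factor [c x], continuous in [x] and
    so large that any [w + 1] coordinates become widely spread, and then drop the
    disks one by one, in the order of their labels, each coming to rest on the
    previous ones that are close enough.  A stack exceeding the strip would come
    from [w + 1] disks with close abscissae, so this gives a continuous map [s]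
    to config(n,w).  Since [r (s x) = c x * x], scaling is a homotopy from the
    identity to [r \o s]; hence [r_* \o s_* = id] in homology and [s_*] is a
    split injection. *)

Set Implicit Arguments.
Unset Strict Implicit.
Unset Printing Implicit Defensive.

Import Order.TTheory GRing.Theory Num.Theory.
Import numFieldNormedType.Exports.

Local Open Scope classical_set_scope.
Local Open Scope ring_scope.

(** * Split injections and maps induced on subquotients *)

Lemma isom_direct_summand_retract (A B : zmodType) (s : {additive A -> B})
  (r : {additive B -> A}) : cancel s r -> isom_direct_summand A B.
Proof.
(* The complement is the kernel of [r], available as the subgroup [cycles r]: each [b] splits as
   [s (r b)] plus [b - s (r b)]. *)
move=> sK; exists (cycles r).
pose phi (p : A * cycles r) : B := s p.1 + \val p.2.
have phi_additive : zmod_morphism phi.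
  by move=> [a c] [a' c']; rewrite /phi /= raddfB opprD addrACA.
have ker_proj b : b - s (r b) \in cycle_pred r.
  by rewrite inE raddfB sK subrr.
exists (HB.pack_for {additive (A * cycles r)%type -> B} phi
         (GRing.isZmodMorphism.Build _ _ phi phi_additive)).
exists (fun b => (r b, Cycle (ker_proj b))) => [[a c]|b]; rewrite /= /phi /=.
  have rc : r (\val c) = 0 by apply/eqP; exact: (valP c).
  have rsac : r (s a + \val c) = a by rewrite raddfD sK rc addr0.
  congr pair; first exact: rsac.
  by apply: val_inj; rewrite /= rsac addrC addKr.
by rewrite addrC subrK.
Qed.

Section InducedMap.
Variables (A B C A' B' C' : zmodType).
Variables (f : {additive A -> B}) (g : {additive B -> C}).
Variables (f' : {additive A' -> B'}) (g' : {additive B' -> C'}).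
Variable h : {additive B -> B'}.
Hypothesis h_cycle : forall b, g b = 0 -> g' (h b) = 0.
Hypothesis h_boundary : forall a, exists a', f' a' = h (f a).

Fact cycle_map_subproof (z : cycles g) : h (\val z) \in cycle_pred g'.
Proof. by rewrite inE; apply/eqP/h_cycle/eqP; exact: (valP z). Qed.

Definition cycle_map (z : cycles g) : cycles g' := Cycle (cycle_map_subproof z).

Fact cycle_map_additive : zmod_morphism cycle_map.
Proof. by move=> z z'; apply: val_inj; rewrite /= !raddfB. Qed.

HB.instance Definition _ := GRing.isZmodMorphism.Build _ _
  cycle_map cycle_map_additive.

Definition ker_mod_im_fun (q : ker_mod_im f g) : ker_mod_im f' g' :=
  (\pi_(ker_mod_im f' g') (cycle_map (repr q)))%qT.

(** Independence of the representative: [repr] of the class of [z] differs from [z] by some [f a],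
    and [h_boundary] turns [h (f a)] into a boundary. *)
Lemma ker_mod_im_funE z :
  ker_mod_im_fun (\pi_(ker_mod_im f g) z)%qT =
  (\pi_(ker_mod_im f' g') (cycle_map z))%qT.
Proof.
apply/eqP; rewrite -Quotient.idealrBE -raddfB inE.
have : repr (\pi_(ker_mod_im f g) z)%qT - z \in boundary_pred f (g := g).
  by rewrite Quotient.idealrBE reprK.
rewrite inE => -[a fa]; have [a' fa'] := h_boundary a.
by exists a'; rewrite fa' fa.
Qed.

Fact ker_mod_im_fun_additive : zmod_morphism ker_mod_im_fun.
Proof.
move=> p q; elim/quotW: p => z; elim/quotW: q => z'.
rewrite -[(\pi z - \pi z')%qT]raddfB !ker_mod_im_funE.
by rewrite !raddfB.
Qed.

Definition ker_mod_im_map : {additive ker_mod_im f g -> ker_mod_im f' g'} :=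
  HB.pack_for {additive ker_mod_im f g -> ker_mod_im f' g'} ker_mod_im_fun
    (GRing.isZmodMorphism.Build _ _ ker_mod_im_fun ker_mod_im_fun_additive).

Lemma ker_mod_im_mapE z :
  ker_mod_im_map (\pi_(ker_mod_im f g) z)%qT =
  (\pi_(ker_mod_im f' g') (cycle_map z))%qT.
Proof. exact: ker_mod_im_funE. Qed.

End InducedMap.

Lemma ker_mod_im_direct_summand (A B C A' B' C' : zmodType)
    (f : {additive A -> B}) (g : {additive B -> C})
    (f' : {additive A' -> B'}) (g' : {additive B' -> C'})
    (s : {additive B -> B'}) (r : {additive B' -> B}) :
    (forall b, g b = 0 -> g' (s b) = 0) -> (forall a, exists a', f' a' = s (f a)) ->
    (forall b, g' b = 0 -> g (r b) = 0) -> (forall a, exists a', f a' = r (f' a)) ->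
    (forall b, g b = 0 -> exists a, f a = r (s b) - b) ->
  isom_direct_summand (ker_mod_im f g) (ker_mod_im f' g').
Proof.
move=> sc sb rc rb rs.
have K : cancel (ker_mod_im_map sc sb) (ker_mod_im_map rc rb).
  move=> q; elim/quotW: q => z.
  rewrite (ker_mod_im_mapE sc sb z) (ker_mod_im_mapE rc rb).
  apply/eqP; rewrite -Quotient.idealrBE inE.
  have [|a fa] := rs (\val z); first by apply/eqP; exact: (valP z).
  by exists a; rewrite fa raddfB.
exact: isom_direct_summand_retract K.
Qed.

(** * The prism operator on lists of vertices *)

Section Prism.
Variables (V W : Type) (bot top : V -> W).

Implicit Types (M N : zmodType).

(** The alternating sum of the values of [phi] on the faces of [s]; see
    [list_boundaryE]. *)
Fixpoint list_boundary (T : Type) M (phi : seq T -> M) (s : seq T) : M :=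
  if s is v :: u then phi u - list_boundary (phi \o cons v) u else 0.

(** Values of [phi] on the simplices of the prism over [s], by the recursion
    [P (v :: u) = bot v :: top v :: top u - bot v :: P u].  Working with values
    of an arbitrary [phi] instead of formal sums of lists makes the homotopy
    formula an induction on [s]. *)
Fixpoint prism M (phi : seq W -> M) (s : seq V) : M :=
  if s is v :: u then
    phi (bot v :: top v :: map top u) - prism (phi \o cons (bot v)) u
  else 0.

Lemma list_boundaryB T M (phi psi : seq T -> M) s :
  list_boundary (fun u => phi u - psi u) s =
  list_boundary phi s - list_boundary psi s.
Proof.
elim: s phi psi => [|v s IHs] phi psi /=; first by rewrite subrr.
by rewrite (IHs (phi \o cons v) (psi \o cons v)) opprD addrACA -opprD.
Qed.

Lemma list_boundary_map (T T' : Type) M (f : T -> T') (phi : seq T' -> M) s :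
  list_boundary phi (map f s) = list_boundary (phi \o map f) s.
Proof. by elim: s phi => //= v s IHs phi; rewrite IHs. Qed.

(** Simplices of the prism have one vertex more than the base, so only that length matters. This
    supplies the size hypotheses of the face formulas. *)
Lemma eq_prism M (phi psi : seq W -> M) s :
  (forall u, size u = (size s).+1 -> phi u = psi u) -> prism phi s = prism psi s.
Proof.
elim: s phi psi => //= v s IHs phi psi eq_phi.
rewrite eq_phi /= ?size_map // (IHs _ (psi \o cons (bot v))) // => u /= su.
by apply: eq_phi; rewrite /= su.
Qed.

Lemma prismB M (phi psi : seq W -> M) s :
  prism (fun u => phi u - psi u) s = prism phi s - prism psi s.
Proof.
elim: s phi psi => [|v s IHs] phi psi /=; first by rewrite subrr.
by rewrite (IHs (phi \o cons (bot v)) (psi \o cons (bot v))) opprD addrACA -opprD.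
Qed.

Lemma prism_additive M N (h : {additive M -> N}) (phi : seq W -> M) s :
  h (prism phi s) = prism (h \o phi) s.
Proof.
by elim: s phi => [|v s IHs] phi /=; rewrite ?raddf0 // raddfB IHs.
Qed.

(** Induction on [s] for all [phi]. Over [v :: u], the terms [prism phi u] cancel, and so do the
    faces containing both [bot v] and [top v]. With [psi := phi \o cons (bot v)], there remains
    [phi (map top (v :: u)) - psi (map top u)] plus the left side for [psi] and [u], which
    telescopes by the induction hypothesis. *)
Lemma prism_homotopy M (phi : seq W -> M) s :
  prism (list_boundary phi) s + list_boundary (prism phi) s =
  phi (map top s) - phi (map bot s).
Proof.
elim: s phi => [|v s IHs] phi /=; first by rewrite addr0 subrr.
rewrite -[list_boundary phi \o _]/(fun u =>
  phi u - list_boundary (phi \o cons (bot v)) u) prismB.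
rewrite -[prism phi \o _]/(fun u =>
  phi (bot v :: top v :: map top u) - prism (phi \o cons (bot v)) u).
rewrite list_boundaryB list_boundary_map.
have := IHs (phi \o cons (bot v)).
rewrite /= -[list_boundary (_ \o map top) s]/(list_boundary (fun u =>
  phi (bot v :: top v :: map top u)) s) => E.
rewrite !opprB -!addrA; congr (_ + _).
rewrite [- prism phi s + _]addrA addNr add0r (addrA (prism _ s)) E.
by rewrite -(addrA (phi _)) (addrA (- phi _)) addNr add0r addrC subrK.
Qed.

End Prism.

Lemma prism_map (V V' W W' : Type) (bot top : V -> W) (bot' top' : V' -> W')
    (f : V -> V') (g : W -> W') (M : zmodType) (phi : seq W' -> M) s :
    (forall v, bot' (f v) = g (bot v)) -> (forall v, top' (f v) = g (top v)) ->
  prism bot' top' phi (map f s) = prism bot top (phi \o map g) s.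
Proof.
move=> botE topE; elim: s phi => //= v s IHs phi; rewrite botE topE IHs.
by congr (phi [:: _, _ & _] - _); rewrite -!map_comp; apply: eq_map => x /=.
Qed.

Lemma list_boundaryE (T : Type) (M : zmodType) (phi : seq T -> M) s :
  list_boundary phi s =
  \sum_(i < size s) phi (take i s ++ drop i.+1 s) *~ (-1) ^+ i.
Proof.
elim: s phi => [|v s IHs] phi /=; first by rewrite big_ord0.
rewrite big_ord_recl /= IHs drop0 mulr1z -sumrN; congr (_ + _).
apply: eq_bigr => i _ /=.
by rewrite exprS mulN1r mulrNz.
Qed.

(** * Chain maps induced by continuous maps *)

Section ChainMaps.
Variables (R : realType).
Implicit Types X Y Z : topologicalType.

Lemma eq_chain X j (M : zmodType) (F G : {additive chain R X j -> M}) :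
  (forall s, F << s >> = G << s >>) -> F =1 G.
Proof.
move=> eqFG c; rewrite -[c]freeg_sumE !raddf_sum; apply: eq_bigr => s _.
by rewrite -[coeff s c]intz -freeg_mulz !raddfMz eqFG.
Qed.

Lemma boundaryU X j (s : singular_simplex R X j.+1) :
  boundary (<< s >> : chain R X j.+1) =
  \sum_(i < j.+2) (<< face s i >> : chain R X j) *~ (-1) ^+ i.
Proof.
rewrite /= /face_sum liftU scale1r; apply: eq_bigr => i _.
by rewrite freeg_mulz intz.
Qed.

Definition chain_map X Y (u : continuousType X Y) j :
    chain R X j -> chain R Y j :=
  fglift (fun s : singular_simplex R X j => << (u \o s : singular_simplex R Y j) >>).

Fact chain_map_additive X Y (u : continuousType X Y) j :
  zmod_morphism (@chain_map X Y u j).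
Proof. exact: lift_is_additive. Qed.

HB.instance Definition _ X Y (u : continuousType X Y) j :=
  GRing.isZmodMorphism.Build _ _ (@chain_map X Y u j)
    (chain_map_additive u (j := j)).

Lemma chain_mapU X Y (u : continuousType X Y) j (s : singular_simplex R X j) :
  chain_map u << s >> = << (u \o s : singular_simplex R Y j) >>.
Proof. by rewrite /chain_map liftU scale1r. Qed.

Lemma boundary_chain_map X Y (u : continuousType X Y) j (c : chain R X j) :
  boundary (chain_map u c) = chain_map u (boundary c).
Proof.
case: j c => [|j] c; first by rewrite /= raddf0.
pose F : {additive chain R X j.+1 -> chain R Y j} :=
  @boundary R Y j.+1 \o @chain_map X Y u j.+1.
pose G : {additive chain R X j.+1 -> chain R Y j} :=
  @chain_map X Y u j \o @boundary R X j.+1.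
apply: (eq_chain (F := F) (G := G)) => s.
rewrite -[LHS]/(boundary (chain_map u << s >>)).
rewrite -[RHS]/(chain_map u (boundary (<< s >> : chain R X j.+1))).
rewrite chain_mapU !boundaryU raddf_sum.
apply: eq_bigr => i _; rewrite [RHS]raddfMz /= chain_mapU; congr (<< _ >> *~ _).
exact/continuousEP.
Qed.

Lemma chain_map_comp X Y Z (u : continuousType X Y) (v : continuousType Y Z) j
    (c : chain R X j) :
  chain_map v (chain_map u c) = chain_map (v \o u) c.
Proof.
pose F : {additive chain R X j -> chain R Z j} :=
  @chain_map Y Z v j \o @chain_map X Y u j.
pose G : {additive chain R X j -> chain R Z j} := @chain_map X Z (v \o u) j.
apply: (eq_chain (F := F) (G := G)) => s.
rewrite -[RHS]/(chain_map (v \o u) << s >>).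
rewrite -[LHS]/(chain_map v (chain_map u << s >>)) !chain_mapU; congr (<< _ >>).
exact/continuousEP.
Qed.

Lemma chain_map_id X (u : continuousType X X) j (c : chain R X j) :
  u =1 id -> chain_map u c = c.
Proof.
move=> uid; pose F : {additive chain R X j -> chain R X j} := @chain_map X X u j.
apply: (eq_chain (F := F) (G := idfun)) => s.
rewrite -[LHS]/(chain_map u << s >>) chain_mapU; congr (<< _ >>).
by apply/continuousEP => t /=; rewrite uid.
Qed.

End ChainMaps.

(** * Affine maps between standard simplices *)

Section VertexMap.
Variable R : realType.

(** In barycentric coordinates, the affine map sending vertex [l] to vertex [f l]. Weights of
    vertices with the same image add up, as happens when a prism is projected to its base. *)
Definition vertex_map_row k j (f : 'I_k.+1 -> 'I_j.+1) (t : 'rV[R]_k.+1) :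
  'rV[R]_j.+1 := \row_i \sum_(l | f l == i) t 0 l.

Fact vertex_map_row_simplex k j (f : 'I_k.+1 -> 'I_j.+1)
  (t : set_type (std_simplex (R := R) (j := k))) :
  vertex_map_row f (\val t) \in std_simplex (R := R) (j := j).
Proof.
case: t => t /= /set_mem[t0 t1]; apply/mem_set; split=> [i|].
  by rewrite mxE; apply: sumr_ge0.
rewrite -t1 (partition_big f xpredT) //=.
by apply: eq_bigr => i _; rewrite mxE.
Qed.

Definition vertex_map k j (f : 'I_k.+1 -> 'I_j.+1)
    (t : set_type (std_simplex (R := R) (j := k))) :
    set_type (std_simplex (R := R) (j := j)) :=
  exist (fun v => v \in std_simplex (R := R) (j := j)) _
    (vertex_map_row_simplex f t).

Lemma continuous_mx (T : topologicalType) (U : topologicalType) m n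
    (F : T -> 'M[U]_(m, n)) :
  (forall i j, continuous (fun t => F t i j)) -> continuous F.
Proof.
move=> cF t A [P Pt PA].
have : \forall t' \near t, forall ij : 'I_m * 'I_n, P ij.1 ij.2 (F t' ij.1 ij.2).
  apply: filter_forall => -[i j]; apply: cF; exact: Pt.
by apply: filterS => t' Pt'; apply: PA => i j; exact: (Pt' (i, j)).
Qed.

Lemma continuous_set_type (T : topologicalType) (U : topologicalType)
    (A : set U) (F : T -> set_type A) :
  continuous (fun t => \val (F t)) -> continuous F.
Proof. by move=> cF; apply: continuous_comp_initial. Qed.

Lemma continuous_coord m n (A : set 'M[R]_(m, n)) i j :
  continuous (fun t : set_type A => \val t i j).
Proof.
move=> t; apply: (@continuous_comp _ _ _ _ (fun x : 'M[R]_(m, n) => x i j)).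
  exact: initial_continuous.
exact: coord_continuous.
Qed.

Lemma continuous_sum (T : topologicalType) (I : Type) (r : seq I) (P : pred I)
    (F : I -> T -> R) :
  (forall i, P i -> continuous (F i)) ->
  continuous (fun t => \sum_(i <- r | P i) F i t).
Proof. by move=> cF; apply: continuous_big => //; exact: add_continuous. Qed.

Lemma vertex_map_continuous k j (f : 'I_k.+1 -> 'I_j.+1) :
  continuous (vertex_map f).
Proof.
apply/continuous_set_type/continuous_mx => i l /=.
under eq_fun do rewrite mxE.
by apply: continuous_sum => m _; exact: continuous_coord.
Qed.

HB.instance Definition _ k j (f : 'I_k.+1 -> 'I_j.+1) :=
  isContinuous.Build _ _ (vertex_map f) (vertex_map_continuous (f := f)).

Lemma vertex_map_coface k j (f : 'I_k.+2 -> 'I_j.+1) i t :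
  vertex_map f (coface i t) = vertex_map (f \o lift i) t.
Proof.
apply: val_inj; apply/rowP => m; rewrite !mxE big_mkcond /= (bigD1_ord i) //=.
rewrite mxE unlift_none if_same add0r [RHS]big_mkcond.
by apply: eq_bigr => l _; rewrite mxE liftK.
Qed.

Lemma coface_vertex_map k j (f : 'I_k.+1 -> 'I_j.+1) i t :
  coface i (vertex_map f t) = vertex_map (lift i \o f) t.
Proof.
apply: val_inj; apply/rowP => m; rewrite !mxE.
case: unliftP => [l ->|->] /=.
  by rewrite mxE; apply: eq_bigl => p; rewrite (inj_eq lift_inj).
by rewrite big1 // => p /eqP/esym/eqP; rewrite (negPf (neq_lift _ _)).
Qed.

Lemma eq_vertex_map k j (f g : 'I_k.+1 -> 'I_j.+1) :
  f =1 g -> vertex_map f =1 vertex_map g.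
Proof.
move=> fg t; apply: val_inj; apply/rowP => m; rewrite !mxE.
by apply: eq_bigl => l; rewrite fg.
Qed.

Lemma vertex_map_id k (t : set_type (std_simplex (R := R) (j := k))) :
  vertex_map id t = t.
Proof. by apply: val_inj; apply/rowP => m; rewrite !mxE big_pred1_eq. Qed.

End VertexMap.

(** * From a homotopy of maps to a chain homotopy *)

Section Homotopy.
Variables (R : realType) (X Y : topologicalType).
Variable H : X * R -> Y.
Hypothesis H_continuous : continuous H.

(** The list [u] gives vertices of the prism over [s], each a vertex of the base with its level,
    bottom or top; the map is [H] on the affine simplex they span. The default of [nth] is never
    reached when [size u = k.+1]. *)
Definition prism_simplex_fun j (s : singular_simplex R X j) k
    (u : seq ('I_j.+1 * bool)) (t : set_type (std_simplex (R := R) (j := k))) : Y :=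
  H (s (vertex_map (fun l : 'I_k.+1 => (nth (ord0, false) u l).1) t),
     \sum_(l < k.+1) \val t 0 l * (nth (ord0, false) u l).2%:R).

Fact prism_simplex_continuous j (s : singular_simplex R X j) k u :
  continuous (@prism_simplex_fun j s k u).
Proof.
pose height (t : set_type (std_simplex (R := R) (j := k))) : R :=
  \sum_(l < k.+1) \val t 0 l * (nth (ord0, false) u l).2%:R.
pose point (t : set_type (std_simplex (R := R) (j := k))) : X :=
  s (vertex_map (fun l : 'I_k.+1 => (nth (ord0, false) u l).1) t).
have height_continuous : continuous height.
  apply: continuous_sum => l _ t.
  have coord_l := @continuous_coord R 1 k.+1 (std_simplex (R := R) (j := k)) 0 l.
  exact: (cvgM (coord_l t) (cvg_cst _)).
have point_continuous : continuous point.
  move=> t; apply: continuous_comp; first exact: vertex_map_continuous.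
  exact: cts_fun.
move=> t; apply: (@continuous_comp _ _ _ (fun t => (point t, height t)) H).
  exact: cvg_pair (point_continuous t) (height_continuous t).
exact: H_continuous.
Qed.

HB.instance Definition _ j (s : singular_simplex R X j) k u :=
  isContinuous.Build _ _ (@prism_simplex_fun j s k u)
    (@prism_simplex_continuous j s k u).

Definition prism_simplex j (s : singular_simplex R X j) k
    (u : seq ('I_j.+1 * bool)) : singular_simplex R Y k :=
  @prism_simplex_fun j s k u.

Lemma face_prism_simplex j (s : singular_simplex R X j) k
    (u : seq ('I_j.+1 * bool)) (i : 'I_k.+2) : size u = k.+2 ->
  face (prism_simplex s k.+1 u) i = prism_simplex s k (take i u ++ drop i.+1 u).
Proof.
move=> su; apply/continuousEP => t; rewrite /= /prism_simplex_fun.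
have nthE (l : 'I_k.+1) :
    nth (ord0, false) (take i u ++ drop i.+1 u) l = nth (ord0, false) u (lift i l).
  rewrite nth_cat size_take su ltn_ord /= /bump; case: ltnP => li.
    by rewrite nth_take.
  by rewrite nth_drop addSn subnKC.
rewrite vertex_map_coface; congr (H (s _, _)).
  by apply: eq_vertex_map => l /=; rewrite nthE.
rewrite (bigD1_ord i) //= mxE unlift_none mul0r add0r.
by apply: eq_bigr => l _; rewrite mxE liftK nthE.
Qed.

Lemma prism_simplex_face j (s : singular_simplex R X j.+1) k
    (u : seq ('I_j.+1 * bool)) (i : 'I_j.+2) : size u = k.+1 ->
  prism_simplex (face s i) k u =
  prism_simplex s k (map (fun p => (lift i p.1, p.2)) u).
Proof.
move=> su; apply/continuousEP => t; rewrite /= /prism_simplex_fun /=.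
have nthE (l : 'I_k.+1) :
    nth (ord0, false) (map (fun p => (lift i p.1, p.2)) u) l =
    (lift i (nth (ord0, false) u l).1, (nth (ord0, false) u l).2).
  by rewrite (nth_map (ord0, false)) // su.
rewrite coface_vertex_map; congr (H (s _, _)).
  by apply: eq_vertex_map => l /=; rewrite nthE.
by apply: eq_bigr => l _; rewrite nthE.
Qed.

Lemma prism_simplex_end j (s : singular_simplex R X j) (b : bool) t :
  prism_simplex s j (map (pair^~ b) (enum 'I_j.+1)) t = H (s t, b%:R).
Proof.
have nthE (l : 'I_j.+1) :
    nth (ord0, false) (map (pair^~ b) (enum 'I_j.+1)) l = (l, b).
  by rewrite (nth_map ord0) ?nth_ord_enum // size_enum_ord.
rewrite /= /prism_simplex_fun; congr (H (_, _)).
  rewrite -[in RHS](vertex_map_id t); congr (s _).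
  by apply: eq_vertex_map => l; rewrite nthE.
under eq_bigr do rewrite nthE /=.
by rewrite -mulr_suml; case: t => t /= /set_mem[_ ->]; rewrite mul1r.
Qed.

(** Identifies the sublists occurring in [list_boundaryE] with vertex lists relabelled by a coface,
    so that they can be read as faces of the base. *)
Lemma enum_ord_face j (i : 'I_j.+2) :
  take i (enum 'I_j.+2) ++ drop i.+1 (enum 'I_j.+2) =
  map (lift i) (enum 'I_j.+1).
Proof.
have size_t : size (take i (enum 'I_j.+2)) = i.
  by rewrite size_takel // size_enum_ord ltnW.
have size_td : size (take i (enum 'I_j.+2) ++ drop i.+1 (enum 'I_j.+2)) = j.+1.
  by rewrite size_cat size_t size_drop size_enum_ord; have := ltn_ord i; lia.
apply: (@eq_from_nth _ ord0) => [|l].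
  by rewrite size_td size_map size_enum_ord.
rewrite size_td => lt_l.
rewrite nth_cat size_t.
rewrite (nth_map ord0) ?size_enum_ord // (nth_ord_enum ord0 (Ordinal lt_l)).
apply: val_inj; rewrite /= /bump; case: ltnP => li.
  by rewrite nth_take // nth_enum_ord // ltnW.
by rewrite nth_drop addSn subnKC // nth_enum_ord.
Qed.

Definition prism_op_simplex j (s : singular_simplex R X j) : chain R Y j.+1 :=
  prism (pair^~ false) (pair^~ true)
    (fun u => << prism_simplex s j.+1 u >> : chain R Y j.+1) (enum 'I_j.+1).

Definition prism_op j : chain R X j -> chain R Y j.+1 :=
  fglift (@prism_op_simplex j).

Fact prism_op_additive j : zmod_morphism (@prism_op j).
Proof. exact: lift_is_additive. Qed.

HB.instance Definition _ j :=
  GRing.isZmodMorphism.Build _ _ (@prism_op j) (@prism_op_additive j).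

Lemma prism_opU j (s : singular_simplex R X j) :
  prism_op << s >> = prism_op_simplex s.
Proof. by rewrite /prism_op liftU scale1r. Qed.

(** Faces of prism simplices are deletions in their vertex lists, so [boundary] acts under [prism]
    as [list_boundary], and [prism_homotopy] applies. The last term is the prism over the faces of
    [s]. *)
Lemma boundary_prism_op_simplex j (s : singular_simplex R X j) :
  boundary (prism_op_simplex s) =
  << prism_simplex s j (map (pair^~ true) (enum 'I_j.+1)) >> -
  << prism_simplex s j (map (pair^~ false) (enum 'I_j.+1)) >> -
  list_boundary (prism (pair^~ false) (pair^~ true)
    (fun u => << prism_simplex s j u >> : chain R Y j)) (enum 'I_j.+1).
Proof.
rewrite -(@prism_homotopy _ _ (pair^~ false) (pair^~ true) (chain R Y j)
  (fun u => << prism_simplex s j u >>)) addrK.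
rewrite (prism_additive _ _ (@boundary R Y j.+1)); apply: eq_prism => u.
rewrite size_enum_ord => su.
rewrite [LHS]boundaryU list_boundaryE su; apply: eq_bigr => i _.
by rewrite face_prism_simplex.
Qed.

(* On non-cycles the formula has the further term [prism_op (boundary c)]. *)
Lemma prism_op_homotopy j (h0 h1 : continuousType X Y) (c : chain R X j) :
  (forall x, h0 x = H (x, 0)) -> (forall x, h1 x = H (x, 1)) ->
  boundary c = 0 -> boundary (prism_op c) = chain_map h1 c - chain_map h0 c.
Proof.
move=> h0E h1E.
have endE (s : singular_simplex R X j) :
    << prism_simplex s j (map (pair^~ true) (enum 'I_j.+1)) >> -
    << prism_simplex s j (map (pair^~ false) (enum 'I_j.+1)) >> =
    chain_map h1 << s >> - chain_map h0 << s >>.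
  rewrite !chain_mapU; congr (<< _ >> - << _ >>); apply/continuousEP => t.
    by rewrite prism_simplex_end /= h1E.
  by rewrite prism_simplex_end /= h0E.
(* Degree 0 stands apart: the only face of a one-vertex list is empty, and the prism over it is
   0. *)
case: j c endE => [|j] c endE c0.
  pose F : {additive chain R X 0 -> chain R Y 0} := @boundary R Y 1 \o @prism_op 0.
  pose G : {additive chain R X 0 -> chain R Y 0} :=
    @chain_map R X Y h1 0 \- @chain_map R X Y h0 0.
  apply: (eq_chain (F := F) (G := G)) => s.
  rewrite -[LHS]/(boundary (prism_op << s >>)).
  rewrite -[RHS]/(chain_map h1 << s >> - chain_map h0 << s >>).
  rewrite prism_opU boundary_prism_op_simplex endE.
  have -> : enum 'I_1 = [:: ord0].
    by rewrite enum_ordSl (size0nil (s := enum 'I_0)) ?size_enum_ord.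
  by rewrite /= subrr subr0.
pose F : {additive chain R X j.+1 -> chain R Y j.+1} :=
  (@boundary R Y j.+2 \o @prism_op j.+1) \+ (@prism_op j \o @boundary R X j.+1).
pose G : {additive chain R X j.+1 -> chain R Y j.+1} :=
  @chain_map R X Y h1 j.+1 \- @chain_map R X Y h0 j.+1.
suff FG : F =1 G.
  by have := FG c; rewrite /F /G /= -/(boundary c) c0 raddf0 addr0.
apply: eq_chain => s.
rewrite -[LHS]/(boundary (prism_op << s >>) +
  prism_op (boundary (<< s >> : chain R X j.+1))).
rewrite -[RHS]/(chain_map h1 << s >> - chain_map h0 << s >>).
rewrite prism_opU boundary_prism_op_simplex endE -addrA -[RHS]addr0.
congr (_ + _).
rewrite addrC; apply/eqP; rewrite subr_eq0; apply/eqP.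
(* Term [i] of either sum is the prism over face [i] of [s]: on the left as a simplex of its own, on
   the right inside [s] with vertices relabelled by [lift i]. *)
rewrite boundaryU raddf_sum list_boundaryE size_enum_ord.
apply: eq_bigr => i _; rewrite [LHS]raddfMz /= prism_opU enum_ord_face.
rewrite (prism_map (f := lift i) (g := fun p => (lift i p.1, p.2))
  (bot := pair^~ false) (top := pair^~ true)) //.
congr (_ *~ _); apply: eq_prism => u; rewrite size_enum_ord => su.
by rewrite prism_simplex_face.
Qed.

End Homotopy.

(* [H] is only constrained at times 0 and 1; letting time range over all of [R]
   spares the subspace topology of the unit interval. *)
Theorem homology_direct_summand (R : realType) (X Y : topologicalType) j
    (s : continuousType X Y) (r : continuousType Y X) (H : X * R -> X) :
  continuous H -> (forall x, H (x, 0) = x) -> (forall x, H (x, 1) = r (s x)) ->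
  isom_direct_summand (homology R X j) (homology R Y j).
Proof.
move=> cH H0 H1.
apply: (ker_mod_im_direct_summand (s := @chain_map R X Y s j)
         (r := @chain_map R Y X r j)).
- move=> b b0; apply: etrans (boundary_chain_map s b) _.
  by rewrite [boundary b]b0 raddf0.
- by move=> a; exists (chain_map s a); exact: (@boundary_chain_map R X Y s j.+1 a).
- move=> b b0; apply: etrans (boundary_chain_map r b) _.
  by rewrite [boundary b]b0 raddf0.
- by move=> a; exists (chain_map r a); exact: (@boundary_chain_map R Y X r j.+1 a).
move=> b b0; exists (prism_op cH b).
apply: etrans (prism_op_homotopy cH (h0 := idfun) (h1 := r \o s) _ _ b0) _ => //.
by rewrite [chain_map idfun b]chain_map_id //= -chain_map_comp.
Qed.

(** * Spreading the points and stacking the disks *)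

Section Stacking.
Variables (R : realType) (n w : nat).
Hypothesis w_gt0 : (0 < w)%N.
Implicit Types (x : 'rV[R]_n) (A : {set 'I_n}).

(** A polynomial measure of how far the coordinates in [A] are from being all equal; it is
    homogeneous of degree 2. *)
Definition dispersion A x : R := \sum_(i in A) \sum_(j in A) (x 0 i - x 0 j) ^+ 2.

(** Bounds the dispersion of [w.+1] coordinates lying within [w * (2 * w)] of a common value:
    [w.+1 ^ 2] ordered pairs, each at distance at most [w * (4 * w)]. *)
Definition spread : R := (w.+1 ^ 2 * (w * (4 * w)) ^ 2)%:R.

Definition scaling x : R :=
  1 + \sum_(A : {set 'I_n} | #|A| == w.+1) spread / dispersion A x.

Lemma dispersion_ge0 A x : 0 <= dispersion A x.
Proof. by apply: sumr_ge0 => i _; apply: sumr_ge0 => j _; exact: sqr_ge0. Qed.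

Lemma dispersion_gt0 A x : no_equal R w.+1 n x -> #|A| = w.+1 -> 0 < dispersion A x.
Proof.
move=> /(_ A) nex cardA; rewrite lt_neqAle dispersion_ge0 andbT eq_sym.
apply/eqP => disp0; apply: (nex cardA) => i j iA jA.
have : \sum_(j in A) (x 0 i - x 0 j) ^+ 2 = 0.
  apply: (psumr_eq0P _ disp0) => // k _.
  by apply: sumr_ge0 => l _; exact: sqr_ge0.
move/psumr_eq0P => /(_ (fun k _ => sqr_ge0 _) j jA)/eqP.
by rewrite sqrf_eq0 subr_eq0 => /eqP.
Qed.

Lemma dispersionZ A (c : R) x : dispersion A (c *: x) = c ^+ 2 * dispersion A x.
Proof.
rewrite /dispersion mulr_sumr; apply: eq_bigr => i _.
rewrite mulr_sumr; apply: eq_bigr => j _.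
by rewrite !mxE -mulrBr exprMn.
Qed.

Lemma no_equalZ (c : R) x : 0 < c -> no_equal R w.+1 n x -> no_equal R w.+1 n (c *: x).
Proof.
move=> c_gt0 nex A cardA eqA; apply: (nex A cardA) => i j iA jA.
by have := eqA i j iA jA; rewrite !mxE => /(mulfI (lt0r_neq0 c_gt0)).
Qed.

Lemma spread_gt0 : 0 < spread.
Proof. by rewrite ltr0n; nia. Qed.

Lemma scaling_ge1 x : 1 <= scaling x.
Proof.
rewrite lerDl; apply: sumr_ge0 => A _.
by rewrite divr_ge0 ?dispersion_ge0 // ltW // spread_gt0.
Qed.

(** With [q := spread / d], the summand of [A] makes the factor at least [1 + q], and
    [(1 + q) ^ 2 > q]; the leading 1 covers small [q]. *)
Lemma dispersion_scaling A x : no_equal R w.+1 n x -> #|A| = w.+1 ->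
  spread < dispersion A (scaling x *: x).
Proof.
move=> nex cardA; have d_gt0 := dispersion_gt0 nex cardA.
rewrite dispersionZ; set d := dispersion A x in d_gt0 *.
have q_gt0 : 0 < spread / d by rewrite divr_gt0 // spread_gt0.
have le_scaling : 1 + spread / d <= scaling x.
  rewrite lerD2l (bigD1 A) /= ?cardA ?eqxx // lerDl.
  apply: sumr_ge0 => B _.
  by rewrite divr_ge0 ?dispersion_ge0 // ltW // spread_gt0.
have spreadE : spread = spread / d * d by rewrite divfK // gt_eqF.
rewrite spreadE ltr_pM2r //; nra.
Qed.

(* The fuel [k] makes the recursion on labels structural; [height n] is the
   height at rest.  [1 - d ^+ 2 / 2] majorizes [sqrt (1 - d ^+ 2)], so disk j
   clears disk i, and is so negative for large [d] that disk i has no effect. *)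
Fixpoint height (k : nat) x (j : 'I_n) : R :=
  if k is k'.+1 then
    \big[Num.max/2^-1]_(i < n | (i < j)%N)
      (height k' x i + 1 - (x 0 i - x 0 j) ^+ 2 / 2)
  else 2^-1.

(** The height of disk [j] involves smaller labels only, so the recursion bottoms out after at most
    [j] steps. *)
Lemma height_stable k x (j : 'I_n) : (j <= k)%N -> height k.+1 x j = height k x j.
Proof.
elim: k j => [|k IHk] j le_jk.
  by rewrite /= big_pred0 // => i; apply/negbTE; lia.
rewrite [LHS]/= [RHS]/=; apply: eq_bigr => i lt_ij.
by rewrite -[X in X + 1]/(height k.+1 x i) IHk //; lia.
Qed.

Lemma heightE x j : height n x j =
  \big[Num.max/2^-1]_(i < n | (i < j)%N)
    (height n x i + 1 - (x 0 i - x 0 j) ^+ 2 / 2).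
Proof. by rewrite -[LHS]height_stable // ltnW. Qed.

Lemma height_ge x j : 2^-1 <= height n x j.
Proof. by rewrite heightE; exact: bigmax_ge_id. Qed.

Lemma height_step x (i j : 'I_n) : (i < j)%N ->
  height n x i + 1 - (x 0 i - x 0 j) ^+ 2 / 2 <= height n x j.
Proof. by move=> ij; rewrite [leRHS]heightE; exact: le_bigmax_cond. Qed.

Lemma height_attained x j : height n x j = 2^-1 \/
  exists2 i : 'I_n, (i < j)%N &
    height n x j = height n x i + 1 - (x 0 i - x 0 j) ^+ 2 / 2.
Proof.
rewrite heightE; elim/big_ind: _ => [|a b|i lt_ij]; first by left.
  by move=> Ha Hb; case: (leP a b).
by right; exists i.
Qed.

Lemma height_separated x i j : i != j ->
  1 <= (x 0 i - x 0 j) ^+ 2 + (height n x i - height n x j) ^+ 2.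
Proof.
wlog lt_ij : i j / (i < j)%N => [hw|_].
  rewrite neq_ltn => /orP[ij|ji]; first by apply: hw; rewrite // neq_ltn ij.
  rewrite -[X in X + _]sqrrN opprB -[X in _ + X]sqrrN opprB.
  by apply: hw; rewrite // neq_ltn ji.
have := height_step x lt_ij; move: (height n x i) (height n x j) => a b.
have := sqr_ge0 (x 0 i - x 0 j).
move: ((x 0 i - x 0 j) ^+ 2) => d d_ge0 step.
have [|d_lt1] := leP 1 d; first by have := sqr_ge0 (a - b); lra.
(* Here [d] is the squared offset, and the squared vertical gap is at least
   [(1 - d / 2) ^ 2 = 1 - d + d ^ 2 / 4]. *)
have : 0 <= (b - a - (1 - d / 2)) by lra.
nra.
Qed.

(* The disks of [A] carry disk j from disk i upwards through [m] contacts; the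
   last clause says that either some contact is so loose that it costs a height of
   at least [w], or all abscissae are close. *)
Definition stacked m x (i j : 'I_n) A : Prop :=
  [/\ #|A| = m.+1, (i + m <= j)%N,
      (forall a, a \in A -> (i <= a)%N),
      height n x j <= height n x i + m%:R &
      height n x j <= height n x i + m%:R - w%:R \/
      forall a, a \in A -> `|x 0 a - x 0 i| <= m%:R * (2 * w%:R)].

(** Follow contacts downwards from disk [j], each accounting for at most 1 in height. Either the
    floor is met after at most [m.-1] of them, or [m] contacts are collected. *)
Lemma height_chain m x j : height n x j <= 2^-1 + (m.-1)%:R \/
  exists i A, stacked m x i j A.
Proof.
have w_ge1 : 1 <= w%:R :> R by rewrite ler1n.
elim: m => [|m [IHm|[i [A [cardA le_ij A_ge yij far]]]]].
- right; exists j, [set j]%SET; split; rewrite ?cards1 ?addn0 ?addr0 //.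
    by move=> a /set1P->.
  by right=> a /set1P->; rewrite subrr normr0 mul0r.
- by left; apply: le_trans IHm _; rewrite lerD2l ler_nat leq_pred.
have [yi|[k lt_ki yi]] := height_attained x i; first by left; rewrite -yi.
right; exists k, (k |: A)%SET.
have kA : k \notin A by apply/negP => /A_ge; rewrite leqNgt lt_ki.
have sq_ge0 := sqr_ge0 (x 0 k - x 0 i).
rewrite /stacked -natr1; split; rewrite ?cardsU1 ?kA ?cardA //.
- by lia.
- by move=> a /setU1P[->//|/A_ge]; lia.
- by lra.
case: far => [far|near]; first by left; lra.
(* An offset of at least [2 * w] lowers the step by at least [2 * w ^ 2], hence by at least [w]. *)
have [big|small] := lerP (2 * w%:R) `|x 0 k - x 0 i|.
  left; have : (2 * w%:R) ^+ 2 <= (x 0 k - x 0 i) ^+ 2 :> R.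
    by rewrite -[leRHS]real_normK ?num_real // ler_sqr ?nnegrE ?mulr_ge0 // ?ler0n.
  by nra.
right=> a /setU1P[->|aA].
  by rewrite subrr normr0 mulr_ge0 ?addr_ge0 // ?mulr_ge0 ?ler0n.
rewrite -(subrKA (x 0 i)) (le_trans (ler_normD _ _)) // mulrDl mul1r.
by rewrite lerD ?near // distrC ltW.
Qed.

(** Strong induction on the label, following [w] contacts. Meeting the floor earlier gives at most
    [2^-1 + (w - 1)]. A loose contact gives at most the height of disk [i], whose label is smaller
    because [i + w <= j]. Otherwise [w.+1] abscissae are close, contradicting the lower bound on the
    dispersion. *)
Lemma height_le x j :
  (forall A, #|A| = w.+1 -> spread < dispersion A x) ->
  height n x j <= w%:R - 2^-1.
Proof.
move=> disp; have [m le_jm] := ubnP (j : nat); elim: m => // m IHm in j le_jm *.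
have [low|[i [A [cardA le_ij A_ge _ [far|near]]]]] := height_chain w x j.
- by apply: le_trans low _; rewrite -subn1 natrB //; lra.
- have : height n x i <= w%:R - 2^-1 by apply: IHm; lia.
  by lra.
have := disp A cardA; rewrite ltNge => /negP[].
have le_sq a b : a \in A -> b \in A -> (x 0 a - x 0 b) ^+ 2 <= (w%:R * (4 * w%:R)) ^+ 2.
  move=> aA bA; rewrite -[leLHS]real_normK ?num_real //.
  rewrite ler_sqr ?nnegrE ?mulr_ge0 ?ler0n //.
  rewrite -(subrKA (x 0 i)) (le_trans (ler_normD _ _)) //.
  have := near a aA; have := near b bA; rewrite (distrC (x 0 b)); lra.
apply: (@le_trans _ _ (\sum_(a in A) \sum_(b in A) (w%:R * (4 * w%:R)) ^+ 2)).
  by apply: ler_sum => a aA; apply: ler_sum => b bA; exact: le_sq.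
rewrite -2!natrM -natrX !sumr_const cardA -mulrnA -mulrnA /spread mulnn.
by rewrite mulnC.
Qed.

Definition stack x : 'M[R]_(n, 2) :=
  \matrix_(i < n, c < 2) if c == 0 then x 0 i else height n x i.

Lemma stack_config x : (forall A, #|A| = w.+1 -> spread < dispersion A x) ->
  config R n w%:R (stack x).
Proof.
move=> disp; split=> [i j ij|i]; rewrite !mxE /=; first exact: height_separated.
by rewrite height_ge height_le.
Qed.

Lemma abscissa_no_equal (p : 'M[R]_(n, 2)) :
  config R n w%:R p -> no_equal R w.+1 n (\row_i p i 0).
Proof.
move=> [sep strip] A cardA eqA.
(* Pigeonhole on [w] levels of height 1: two disks of [A] on one level would have equal abscissae
   and a vertical distance below 1. *)
pose level i := Num.truncn (p i 1 - 2^-1).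
have level_itv i : (level i)%:R <= p i 1 - 2^-1 < (level i).+1%:R.
  by apply: truncn_itv; have := strip i; lra.
have level_lt i : (level i < w)%N.
  rewrite -(ltr_nat R); have := level_itv i; have := strip i; lra.
have level_inj : {in A &, injective (fun i => Ordinal (level_lt i))}.
  move=> i j iA jA [eq_level]; apply/eqP/negPn/negP => ij.
  have := sep i j ij; have := eqA i j iA jA; rewrite !mxE => ->.
  rewrite subrr expr0n add0r; have := level_itv i; have := level_itv j.
  rewrite eq_level -natr1; nra.
have := max_card [set Ordinal (level_lt i) | i in A]%SET.
by rewrite card_in_imset // card_ord cardA ltnn.
Qed.

End Stacking.

(** * Continuity of heights and of the scaling factor *)

Section Continuity.
Variables (R : realType) (n w : nat).
Hypothesis w_gt0 : (0 < w)%N.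

Lemma continuous_sqr_dist (T : topologicalType) (f g : T -> R) :
  continuous f -> continuous g -> continuous (fun t => (f t - g t) ^+ 2).
Proof.
move=> cf cg.
have cfg : continuous (fun t => f t - g t) by move=> t; exact: cvgB (cf t) (cg t).
by move=> t; exact: cvgM (cfg t) (cfg t).
Qed.

Lemma continuous_height (T : topologicalType) (F : T -> 'rV[R]_n) k j :
  (forall i, continuous (fun t => F t 0 i)) ->
  continuous (fun t => height k (F t) j).
Proof.
move=> cF; elim: k j => [|k IHk] j /=; first exact: cst_continuous.
apply: continuous_big => [u|i _ t].
  apply: (@continuous_max R _ (fun p : R * R => p.1) (fun p : R * R => p.2)).
    exact: cvg_fst.
  exact: cvg_snd.
have step_cvg : height k (F t') i + 1 @[t' --> t] --> height k (F t) i + 1.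
  by apply: cvgD; [exact: IHk | exact: cvg_cst].
apply: (cvgB step_cvg); apply: cvgM; last exact: cvg_cst.
exact: (continuous_sqr_dist (cF i) (cF j)).
Qed.

Lemma continuous_scaling (T : topologicalType) (F : T -> 'rV[R]_n) :
  (forall i, continuous (fun t => F t 0 i)) ->
  (forall t, no_equal R w.+1 n (F t)) -> continuous (fun t => scaling w (F t)).
Proof.
move=> cF neF.
have dispersion_continuous A : continuous (fun t => dispersion A (F t)).
  apply: continuous_sum => i _; apply: continuous_sum => j _.
  exact: continuous_sqr_dist.
have sum_continuous : continuous (fun t =>
    \sum_(A : {set 'I_n} | #|A| == w.+1) spread R w / dispersion A (F t)).
  apply: continuous_sum => A /eqP cardA t.
  (* The denominators vanish nowhere on the space where no [w.+1] coordinates agree. *)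
  have disp_neq0 : dispersion A (F t) != 0.
    by rewrite gt_eqF // (dispersion_gt0 _ cardA).
  exact: cvgM (cvg_cst _) (cvgV disp_neq0 (dispersion_continuous A t)).
rewrite /scaling => t; exact: cvgD (cvg_cst (1 : R)) (sum_continuous t).
Qed.

End Continuity.

Unset Implicit Arguments.

(** * The section, the retraction and the scaling homotopy *)

Theorem corollary2p4 (R : realType) (j n w : nat) (hn : (1 <= n)%N)
    (hw : (1 <= w)%N) :
  isom_direct_summand
    (homology R (set_type (no_equal R w.+1 n)) j)
    (homology R (set_type (config R n w%:R)) j).
Proof.
pose X : topologicalType := set_type (no_equal R w.+1 n).
pose Y : topologicalType := set_type (config R n w%:R).
have coord_continuousX i : continuous (fun x : X => \val x 0 i).
  exact: continuous_coord.
have nex (x : X) : no_equal R w.+1 n (\val x) by exact: set_mem (valP x).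
have section_in (x : X) :
    stack (scaling w (\val x) *: \val x) \in config R n w%:R.
  by apply/mem_set/stack_config => // A cardA; exact: dispersion_scaling.
pose s (x : X) : Y := exist (fun p => p \in config R n w%:R) _ (section_in x).
have coord_in (p : Y) : (\row_i \val p i 0) \in no_equal R w.+1 n.
  by apply/mem_set/abscissa_no_equal => //; exact: set_mem (valP p).
pose r (p : Y) : X := exist (fun x => x \in no_equal R w.+1 n) _ (coord_in p).
(* Time ranges over all of [R]: the absolute value keeps the factor positive at negative times and
   changes nothing at times 0 and 1. *)
have ray_gt0 (x : X) (t : R) : 0 < 1 + `|t| * (scaling w (\val x) - 1).
  by rewrite ltr_pwDl // mulr_ge0 // subr_ge0 scaling_ge1.
have homotopy_in (p : X * R) :
    (1 + `|p.2| * (scaling w (\val p.1) - 1)) *: \val p.1 \in no_equal R w.+1 n.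
  by apply/mem_set/no_equalZ.
pose H (p : X * R) : X :=
  exist (fun x => x \in no_equal R w.+1 n) _ (homotopy_in p).
have scaling_continuous : continuous (fun x : X => scaling w (\val x)).
  exact: continuous_scaling.
have z_continuous i : continuous (fun x : X => (scaling w (\val x) *: \val x) 0 i).
  under eq_fun do rewrite mxE.
  by move=> x; exact: cvgM (scaling_continuous x) (coord_continuousX i x).
have s_continuous : continuous s.
  apply/continuous_set_type/continuous_mx => i c /=.
  under eq_fun do rewrite mxE.
  case: (c == 0); first exact: z_continuous.
  exact: continuous_height.
have r_continuous : continuous r.
  apply/continuous_set_type/continuous_mx => c i /=.
  by under eq_fun do rewrite mxE; exact: continuous_coord.
have H_continuous : continuous H.
  apply/continuous_set_type/continuous_mx => c i /=.
  under eq_fun do rewrite mxE.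
  have coord_fst : continuous (fun p : X * R => \val p.1 c i).
    move=> p; apply: (@continuous_comp _ _ _ (@fst X R) (fun x : X => \val x c i)).
      exact: cvg_fst.
    exact: continuous_coord.
  have scaling_fst : continuous (fun p : X * R => scaling w (\val p.1)).
    move=> p; apply: (@continuous_comp _ _ _ (@fst X R)
             (fun x : X => scaling w (\val x))).
      exact: cvg_fst.
    exact: scaling_continuous.
  have norm_snd : continuous (fun p : X * R => `|p.2|).
    move=> p; apply: (@continuous_comp _ _ _ (@snd X R) (fun t : R => `|t|)).
      exact: cvg_snd.
    exact: norm_continuous.
  have rate_continuous : continuous (fun p : X * R => scaling w (\val p.1) - 1).
    by move=> p; exact: cvgB (scaling_fst p) (cvg_cst (1 : R)).
  have growth_continuous : continuous
      (fun p : X * R => `|p.2| * (scaling w (\val p.1) - 1)).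
    by move=> p; exact: cvgM (norm_snd p) (rate_continuous p).
  have factor_continuous : continuous
      (fun p : X * R => 1 + `|p.2| * (scaling w (\val p.1) - 1)).
    by move=> p; exact: cvgD (cvg_cst (1 : R)) (growth_continuous p).
  by move=> p; exact: cvgM (factor_continuous p) (coord_fst p).
pose s' : continuousType X Y :=
  HB.pack_for (continuousType X Y) s (isContinuous.Build _ _ s s_continuous).
pose r' : continuousType Y X :=
  HB.pack_for (continuousType Y X) r (isContinuous.Build _ _ r r_continuous).
apply: (homology_direct_summand j (s := s') (r := r') H_continuous) => x.
  by apply: val_inj; rewrite /= normr0 mul0r addr0 scale1r.
apply: val_inj; apply/rowP => i; rewrite /= !mxE /=.
by rewrite normr1 mul1r addrC subrK.
Qed.
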